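(* Let $R$ be a right noetherian ring, let $n\ge 1$, and let $S = R[x_1,\delta_1,x_2,\delta_2,\dots,x_n,\delta_n]$ be a ring of iterated differential polynomials over $R$ which satisfies: (a) $\delta_i(R) \subseteq R$ for every $i = 1,\dots,n$; (b) for every $1 \leq j < i \leq n$ there exist $u,v \in R[x_1,\dots,x_{j-1}]$ such that $\delta_i(x_j) = ux_j+v$; (c) if $J$ is a two-sided ideal of $R$ such that $\delta_i(J) \subseteq J$ for every $i = 1,\dots,n$, then either $J = 0$ or $J = R$. Then $I(n) = 0$ for every proper two-sided ideal $I$ of $S$.
   Context: Rings are associative with unit; ''ideal'' means two-sided ideal. For an ideal $I$ of a ring, $I(1) := \bigcap_{k\in\mathbb{N}} I^k$, and inductively $I(m) := (I(m-1))(1)$ for $m\ge 2$. A derivation on a ring $R$ is an additive map $\delta\colon R\to R$ with $\delta(rs)=\delta(r)s+r\delta(s)$ for all $r,s\in R$. The ring of differential polynomials $R[x,\delta]$ is the free left $R$-module with basis $1,x,x^2,\dots$ with multiplication determined by $xr-rx=\delta(r)$ for $r\in R$. A ring of iterated differential polynomials $S=R[x_1,\delta_1,\dots,x_n,\delta_n]$ over $R$ is obtained by iterating this construction: put $R_0=R$ and, for $0\le i<n$, let $\delta_{i+1}$ be a derivation on $R_i$ and $R_{i+1}=R_i[x_{i+1},\delta_{i+1}]$; then $S=R_n$. The subring $R_i$ of $S$ (generated by $R$ and $x_1,\dots,x_i$) is denoted $R[x_1,\dots,x_i]$; for $i=0$ it is $R$. *)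

(* Defs.v *)
From mathcomp Require Import all_boot all_algebra.
From mathcomp Require Import boolp classical_sets.

Set Implicit Arguments.
Unset Strict Implicit.
Unset Printing Implicit Defensive.

Import GRing.Theory.
Local Open Scope classical_set_scope.
Local Open Scope ring_scope.

Definition right_ideal (R : pzRingType) (J : set R) : Prop :=
  zmod_closed (mem J) /\ (forall a r : R, a \in J -> a * r \in J).

Definition ideal (R : pzRingType) (I : set R) : Prop :=
  [/\ zmod_closed (mem I),
      (forall a r : R, a \in I -> a * r \in I) &
      (forall a r : R, a \in I -> r * a \in I)].

Definition right_noetherian (R : pzRingType) : Prop :=
  forall J : nat -> set R,
    (forall k, right_ideal (J k)) ->
    (forall k, J k `<=` J k.+1) ->
    exists m, forall k, (m <= k)%N -> J k = J m.

Definition ideal_mul (R : pzRingType) (I J : set R) : set R :=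
  [set z | exists (m : nat) (a b : 'I_m -> R),
     [/\ (forall k, a k \in I), (forall k, b k \in J) &
         z = \sum_(k < m) a k * b k]].

Definition ideal_pow (R : pzRingType) (I : set R) (k : nat) : set R :=
  iter k (fun J => ideal_mul J I) setT.

Definition ideal_omega (R : pzRingType) (I : set R) : set R :=
  \bigcap_k ideal_pow I k.

(* For m >= 1 this is I(m); the value at m = 0 is I itself. *)
Definition ideal_iter_omega (R : pzRingType) (I : set R) (m : nat) : set R :=
  iter m (@ideal_omega R) I.

(* d is a derivation of the subring A of S; its values outside A are junk. *)
Definition derivation_on (S : pzRingType) (A : set S) (d : S -> S) : Prop :=
  [/\ {in A, forall r, d r \in A},
      {in A &, forall r s, d (r + s) = d r + d s} &
      {in A &, forall r s, d (r * s) = d r * s + r * d s}].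

(* The subset B of S is A[y, d], for A a subring of S, d a derivation of A and
   y in S: B is a free left A-module with basis 1, y, y^2, ... and
   y r - r y = d r for r in A. *)
Definition diff_poly_ring (S : pzRingType) (A : set S) (d : S -> S) (y : S)
    (B : set S) : Prop :=
  [/\ derivation_on A d,
      {in A, forall r, y * r - r * y = d r},
      B = [set s | exists (m : nat) (a : 'I_m -> S),
             (forall k, a k \in A) /\ s = \sum_(k < m) a k * y ^+ k] &
      forall (m : nat) (a : 'I_m -> S), (forall k, a k \in A) ->
        \sum_(k < m) a k * y ^+ k = 0 -> forall k, a k = 0].

(* R[x_1, ..., x_i] as a subring of S, R being identified with its image under
   iota; x_{j+1} is [x j]. *)
Definition subring_upto (n : nat) (R S : pzRingType) (iota : R -> S)
    (x : 'I_n -> S) (i : nat) : set S :=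
  smallest (fun A : set S => subring_closed (mem A))
    (range iota `|` x @` [set j : 'I_n | (j < i)%N]).

(* S = R[x_1, delta_1, ..., x_n, delta_n], up to isomorphism over R.  With
   0-based indices, [delta i] is the derivation delta_{i+1} of
   R_i = R[x_1, ..., x_i]. *)
Definition iterated_diff_poly_ring (n : nat) (R S : pzRingType)
    (iota : {rmorphism R -> S}) (x : 'I_n -> S) (delta : 'I_n -> S -> S) :
    Prop :=
  [/\ injective iota,
      (forall i : 'I_n,
         diff_poly_ring (subring_upto iota x i) (delta i) (x i)
           (subring_upto iota x i.+1)) &
      subring_upto iota x n = setT].

(* Main.v *)
Require Import Defs.
From mathcomp Require Import all_boot all_algebra.
From mathcomp Require Import boolp classical_sets.

Set Implicit Arguments.
Unset Strict Implicit.
Unset Printing Implicit Defensive.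

Import GRing.Theory.
Local Open Scope classical_set_scope.
Local Open Scope ring_scope.

(** Write [R_ i] for the subring generated by [R] and the first [i] variables.
    Every derivation of the tower is the inner derivation of [S] given by its
    variable, so call an ideal of [R_ i] stable when it is closed under the
    commutators with all the later variables.  The theorem is the case [i = n] of:
    every proper stable ideal [I] of [R_ i] satisfies [I(i) = 0].  For [i = 0]
    this is the hypothesis that [R] is simple for the derivations
    ([base_simple]), and the induction step ([iter_omega_in_extension]) concerns
    one extension from [A] to [B = A[x]].

    In the step, Zorn's lemma puts [I] inside a maximal stable ideal [P] of [B].
    Let [J] be the intersection of [P] and [A], which is a proper stable ideal of [A], and let [Q = J[x]].
    The heart of the proof is that [P(1)] is contained in [Q]
    ([omega_in_maximal]).  Granting this, [I(1)] is contained in [J[x]], and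
    since intersections and powers may be taken on coefficients
    ([iter_omega_in_polys]), [I(i+1)] is contained in [J(i)[x]], which is zero by
    induction.

    To see that [P(1)] lies in [Q], let [m] be the least degree of an element of
    [P] outside [Q], and let [L] be the set of the leading coefficients of the
    elements of [P] of degree at most [m].  Three facts are combined.
    - [L] is a stable ideal of [A] ([stable_ideal_lead]); this rests on the shape
      [delta_i(x_j) = u * x_j + v] of the derivations.
    - Maximality of [P] makes [J] prime among stable ideals, so nothing outside
      [J] is multiplied into [J] by [L] ([restrict_prime]).
    - Dividing by elements of degree [m], every element of [P] is multiplied by
      some power of [L] into [B] times these elements, modulo [Q] ([division]).

    Hence an element [g] of [P ^ k.+1] becomes, after multiplication by elements
    of [L], congruent modulo [Q] to [p * h] with [p] in [P ^ k] and [h] in [P] of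
    degree at most [m] ([saturation_pow], [exchange]).  Here [h] may have any
    leading coefficient in [L], and not all of them multiply the leading
    coefficient of [p] into [J]; as [m] is positive, the degree of [p] modulo [Q]
    is therefore smaller than that of [g] ([polys_lt_mod_descend]).  So by
    induction on [k] an element of [P ^ k] of degree less than [k] modulo [Q]
    lies in [Q] ([pow_polys_lt_mod]), and an element of all the powers of [P]
    lies in [Q]. *)

(** * Subgroups, stable ideals and their powers *)

Section StableIdeals.
Context {S : pzRingType}.
Implicit Types (y s a b : S) (A B C I J K U V W Y Z : set S).

Definition ad y s : S := y * s - s * y.

Lemma adB y a b : ad y (a - b) = ad y a - ad y b.
Proof. by rewrite /ad mulrBr mulrBl !opprB addrACA [- (y * b) + _]addrC addrACA. Qed.

Lemma adD y a b : ad y (a + b) = ad y a + ad y b.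
Proof. by rewrite /ad mulrDr mulrDl opprD addrACA. Qed.

Lemma adM y a b : ad y (a * b) = ad y a * b + a * ad y b.
Proof. by rewrite /ad mulrBl mulrBr !mulrA subrKA. Qed.

Lemma mul_ad y s : y * s = s * y + ad y s.
Proof. by rewrite /ad addrC subrK. Qed.

Definition subgroup J : Prop := J 0 /\ forall a b, J a -> J b -> J (a - b).

Section Subgroup.
Context {J : set S} (gJ : subgroup J).

Lemma subgroup0 : J 0. Proof. by case: gJ. Qed.

Lemma subgroupB a b : J a -> J b -> J (a - b). Proof. by case: gJ => _; apply. Qed.

Lemma subgroupN a : J a -> J (- a).
Proof. by rewrite -[- a]sub0r; apply: subgroupB; apply: subgroup0. Qed.

Lemma subgroupD a b : J a -> J b -> J (a + b).
Proof. by move=> ? ?; rewrite -[b]opprK; apply/subgroupB/subgroupN. Qed.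

Lemma subgroup_addr a b : J a -> J (b + a) -> J b.
Proof. by move=> Ja Jba; rewrite -(addrK a b); apply: subgroupB. Qed.

Lemma subgroup_sum m (f : 'I_m -> S) : (forall k, J (f k)) -> J (\sum_k f k).
Proof. by move=> Jf; elim/big_ind: _ => //; [exact: subgroup0|exact: subgroupD]. Qed.

Lemma subgroup_mull c : subgroup [set s | J (c * s)].
Proof.
by split=> [|a b]; rewrite /= ?mulr0 ?mulrBr; [exact: subgroup0|exact: subgroupB].
Qed.

Lemma subgroup_mulr c : subgroup [set s | J (s * c)].
Proof.
by split=> [|a b]; rewrite /= ?mul0r ?mulrBl; [exact: subgroup0|exact: subgroupB].
Qed.

Lemma subgroup_ad y : subgroup [set s | J (ad y s)].
Proof.
split=> [|a b]; last by rewrite /= adB; exact: subgroupB.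
by rewrite /= /ad mulr0 mul0r subr0; exact: subgroup0.
Qed.

End Subgroup.

Definition setadd I J : set S := [set s | exists a b, [/\ I a, J b & s = a + b]].

Lemma subgroup_setadd I J : subgroup I -> subgroup J -> subgroup (setadd I J).
Proof.
move=> gI gJ; split.
  by exists 0, 0; split; [exact: subgroup0|exact: subgroup0|rewrite addr0].
move=> _ _ [a [b [Ia Jb ->]]] [c [d [Ic Jd ->]]].
by exists (a - c), (b - d); split;
  [exact: subgroupB|exact: subgroupB|rewrite opprD addrACA].
Qed.

Lemma setadd_subl I J : J 0 -> I `<=` setadd I J.
Proof. by move=> J0 a Ia; exists a, 0; rewrite addr0. Qed.

Lemma setadd_subr I J : I 0 -> J `<=` setadd I J.
Proof. by move=> I0 a Ja; exists 0, a; rewrite add0r. Qed.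

Lemma ideal_mul_mem I J a b : I a -> J b -> ideal_mul I J (a * b).
Proof.
move=> Ia Jb; exists 1%N, (fun=> a), (fun=> b).
by split=> [k|k|]; rewrite ?inE // big_ord1.
Qed.

Lemma ideal_mul_min I J K : subgroup K ->
  (forall a b, I a -> J b -> K (a * b)) -> ideal_mul I J `<=` K.
Proof.
move=> gK IJK _ [m [a [b [Ia Jb ->]]]]; apply: subgroup_sum => // k.
by apply: IJK; apply: set_mem.
Qed.

Lemma subgroup_ideal_mul I J : subgroup I -> subgroup (ideal_mul I J).
Proof.
move=> gI; split.
  by exists 0%N, (fun=> 0), (fun=> 0); split=> [[]|[]|] //; rewrite big_ord0.
move=> _ _ [m [a [b [Ia Jb ->]]]] [p [c [d [Ic Jd ->]]]].
exists (m + p)%N,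
  (fun k => match split k with inl i => a i | inr i => - c i end),
  (fun k => match split k with inl i => b i | inr i => d i end).
split=> [k|k|].
- case: (split k) => i //; rewrite inE; apply: subgroupN => //; exact: set_mem.
- by case: (split k) => i.
- rewrite big_split_ord /=; congr (_ + _).
    by apply: eq_bigr => i _; rewrite (unsplitK (inl i)).
  rewrite -sumrN; apply: eq_bigr => i _.
  by rewrite (unsplitK (inr i)) mulNr.
Qed.

Record subring_set A : Prop := SubringSet {
  subring_set_subgroup : subgroup A;
  subring_set1 : A 1;
  subring_setM : forall a b, A a -> A b -> A (a * b) }.

(** Derivations enter through the elements [z] of [Z] that induce them by
    commutators, so that [C], [J] and the derivations of all the larger subrings
    live in one ambient ring. *)
Record stable_ideal C Z J : Prop := StableIdeal {
  stable_subset : J `<=` C;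
  stable_subgroup : subgroup J;
  stable_mull : forall c j, C c -> J j -> J (c * j);
  stable_mulr : forall c j, C c -> J j -> J (j * c);
  stable_ad : forall z j, Z z -> J j -> J (ad z j) }.

Lemma stable_ideal0 C Z J : stable_ideal C Z J -> J 0.
Proof. by case=> _ /subgroup0. Qed.

Lemma stable_ideal_add C Z I J :
  subgroup C -> stable_ideal C Z I -> stable_ideal C Z J -> stable_ideal C Z (setadd I J).
Proof.
move=> gC stI stJ; split.
- move=> _ [a [b [Ia Jb ->]]]; apply: (subgroupD gC).
    exact: (stable_subset stI).
  exact: (stable_subset stJ).
- exact: subgroup_setadd (stable_subgroup stI) (stable_subgroup stJ).
- move=> c _ Cc [a [b [Ia Jb ->]]]; exists (c * a), (c * b).
  by split; [exact: (stable_mull stI)|exact: (stable_mull stJ)|rewrite mulrDr].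
- move=> c _ Cc [a [b [Ia Jb ->]]]; exists (a * c), (b * c).
  by split; [exact: (stable_mulr stI)|exact: (stable_mulr stJ)|rewrite mulrDl].
- move=> y _ Zy [a [b [Ia Jb ->]]]; exists (ad y a), (ad y b).
  by split; [exact: (stable_ad stI)|exact: (stable_ad stJ)|rewrite adD].
Qed.

(** The empty product is the subring [B], not the ambient ring; for [B = setT]
    these are the powers and the intersection of powers of an ideal of [S]. *)
Definition pow_in B I k : set S := iter k (fun J => ideal_mul J I) B.

Definition omega_in B I : set S := \bigcap_k pow_in B I k.

Lemma pow_inS B I I' k : I `<=` I' -> pow_in B I k `<=` pow_in B I' k.
Proof.
move=> sI; elim: k => [|k IHk] //= _ [m [a [b [Ha Hb ->]]]].
exists m, a, b; split=> // i; rewrite inE.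
- by apply: IHk; apply: set_mem.
- by apply: sI; apply: set_mem.
Qed.

Lemma iter_omega_inS B I I' k : I `<=` I' ->
  iter k (omega_in B) I `<=` iter k (omega_in B) I'.
Proof.
by move=> sI; elim: k => [|k IHk] //= s Is i _; apply: (pow_inS IHk (Is i _)).
Qed.

Section Powers.
Context {B Y I : set S}.
Hypotheses (sB : subring_set B) (nB : forall y b, Y y -> B b -> B (ad y b)).
Hypothesis stI : stable_ideal B Y I.

Lemma stable_ideal_mul K : stable_ideal B Y K -> stable_ideal B Y (ideal_mul K I).
Proof.
move=> stK; have gKI := @subgroup_ideal_mul K I (stable_subgroup stK).
split=> //.
- apply: ideal_mul_min; first exact: (subring_set_subgroup sB).
  move=> a b Ka Ib; apply: subring_setM => //; first exact: (stable_subset stK).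
  exact: (stable_subset stI).
- move=> c s Bc; move: s; apply: (ideal_mul_min (subgroup_mull gKI c)) => a b Ka Ib /=.
  by rewrite mulrA; apply: ideal_mul_mem => //; exact: (stable_mull stK).
- move=> c s Bc; move: s; apply: (ideal_mul_min (subgroup_mulr gKI c)) => a b Ka Ib /=.
  by rewrite -mulrA; apply: ideal_mul_mem => //; exact: (stable_mulr stI).
- move=> y s Yy; move: s; apply: (ideal_mul_min (subgroup_ad gKI y)) => a b Ka Ib /=.
  rewrite adM; apply: (subgroupD gKI); apply: ideal_mul_mem => //.
    exact: (stable_ad stK).
  exact: (stable_ad stI).
Qed.

Lemma stable_ideal_pow k : stable_ideal B Y (pow_in B I k).
Proof.
elim: k => [|k IHk] /=; last exact: stable_ideal_mul.
split=> //; first exact: (subring_set_subgroup sB).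
- by move=> c j; apply: subring_setM.
- by move=> c j ? ?; apply: subring_setM.
Qed.

Lemma stable_ideal_omega : stable_ideal B Y (omega_in B I).
Proof.
split.
- by move=> s /(_ 0%N Logic.I).
- split=> [k _|a b Ia Ib k _]; first exact: (stable_ideal0 (stable_ideal_pow k)).
  by apply: (subgroupB (stable_subgroup (stable_ideal_pow k))); [exact: Ia|exact: Ib].
- by move=> c j Bc Ij k _; apply: (stable_mull (stable_ideal_pow k)) => //; exact: Ij.
- by move=> c j Bc Ij k _; apply: (stable_mulr (stable_ideal_pow k)) => //; exact: Ij.
- by move=> c j Bc Ij k _; apply: (stable_ad (stable_ideal_pow k)) => //; exact: Ij.
Qed.

End Powers.

Lemma stable_ideal_iter_omega B Y I k : subring_set B ->
  (forall y b, Y y -> B b -> B (ad y b)) -> stable_ideal B Y I ->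
  stable_ideal B Y (iter k (omega_in B) I).
Proof. by move=> sB nB stI; elim: k => //= k; apply: stable_ideal_omega. Qed.

(** Zorn's lemma applies because being proper means avoiding [1], a condition
    that passes to unions of chains. *)
Lemma exists_maximal_stable_ideal C Z I : stable_ideal C Z I -> ~ I 1 ->
  exists P, [/\ stable_ideal C Z P, ~ P 1, I `<=` P &
    forall K, stable_ideal C Z K -> ~ K 1 -> P `<=` K -> K `<=` P].
Proof.
move=> stI I1.
(* [I] is added to each set because the union of the empty chain is empty. *)
pose good (X : set S) := stable_ideal C Z (I `|` X) /\ ~ (I `|` X) 1.
have [|P0 [[stP P1] maxP]] := @Zorn_bigcup S good; last first.
  exists (I `|` P0); split=> // K stK K1 sPK s Ks.
  apply: contrapT => nPs; apply: (maxP K).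
    split=> [r P0r|sKP]; first by apply: sPK; right.
    by apply: nPs; right; apply: sKP.
  by rewrite /good (_ : I `|` K = K) //; apply/setUidPr => r Ir; apply: sPK; left.
move=> F goodF totF; set X := \bigcup_(X in F) X.
have memF X0 : F X0 -> I `|` X0 `<=` I `|` X.
  by move=> FX0 r [|X0r]; [left|right; exists X0].
(* Two elements of the union of a chain lie in a common member. *)
have pick2 a b : (I `|` X) a -> (I `|` X) b -> exists G,
    [/\ stable_ideal C Z G, G `<=` I `|` X, G a & G b].
  move=> [Ia|[X1 F1 X1a]] [Ib|[X2 F2 X2b]].
  - by exists I; split=> // r; left.
  - by exists (I `|` X2); split; [case: (goodF _ F2)|exact: memF|left|right].
  - by exists (I `|` X1); split; [case: (goodF _ F1)|exact: memF|right|left].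
  - have [s12|s21] := totF _ _ F1 F2.
      by exists (I `|` X2); split; [case: (goodF _ F2)|exact: memF|right; apply: s12|right].
    by exists (I `|` X1); split; [case: (goodF _ F1)|exact: memF|right|right; apply: s21].
split; last first.
  by move=> [//|[X1 F1 X11]]; case: (goodF _ F1) => _; apply; right.
split.
- by move=> a Ia; have [G [stG _ Ga _]] := pick2 a a Ia Ia; apply: (stable_subset stG).
- split=> [|a b Ia Ib]; first by left; exact: (stable_ideal0 stI).
  have [G [stG sG Ga Gb]] := pick2 a b Ia Ib.
  by apply: sG; apply: (subgroupB (stable_subgroup stG)).
- move=> c a Cc Ia; have [G [stG sG Ga _]] := pick2 a a Ia Ia.
  by apply: sG; apply: (stable_mull stG).
- move=> c a Cc Ia; have [G [stG sG Ga _]] := pick2 a a Ia Ia.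
  by apply: sG; apply: (stable_mulr stG).
- move=> c a Cc Ia; have [G [stG sG Ga _]] := pick2 a a Ia Ia.
  by apply: sG; apply: (stable_ad stG).
Qed.


(** A form of being multiplied into [X] by a power of [L] that needs no bound
    on the exponent: the number of factors may depend on the factors already
    chosen. *)
Inductive saturation (L X : set S) (s : S) : Prop :=
| saturation_base of X s
| saturation_step of forall l, L l -> saturation L X (s * l).

Lemma saturation_mull L X X' a : (forall s, X s -> X' (a * s)) ->
  forall s, saturation L X s -> saturation L X' (a * s).
Proof.
move=> XX' s; elim=> {}s => [Xs|_ IHs]; first by apply/saturation_base/XX'.
by apply: saturation_step => l /IHs; rewrite mulrA.
Qed.

(** The two summands may need different numbers of factors; [X] being closed
    under multiplication by [L], the one that is ready first waits. *)
Lemma subgroup_saturation L X : subgroup X ->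
  (forall s l, X s -> L l -> X (s * l)) -> subgroup (saturation L X).
Proof.
move=> gX XL; split; first exact/saturation_base/subgroup0.
have satL s l : saturation L X s -> L l -> saturation L X (s * l).
  by case=> [Xs|sLs] Ll; [apply/saturation_base/XL|apply: sLs].
have baseB a b : X a -> saturation L X b -> saturation L X (a - b).
  move=> Xa sb; elim: sb a Xa => {}b => [Xb|_ IHb] a Xa.
    exact/saturation_base/subgroupB.
  by apply: saturation_step => l Ll; rewrite mulrBl; apply: IHb => //; apply: XL.
move=> a b sa; elim: sa b => {}a => [Xa|_ IHa] b sb; first exact: baseB.
by apply: saturation_step => l Ll; rewrite mulrBl; apply: IHa => //; apply: satL.
Qed.

End StableIdeals.
(** * Polynomials in one element, with coefficients on the left *)

Section Polynomials.
Context {S : pzRingType} (x : S).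
Implicit Types (a b c g h s y : S) (J K U V W : set S) (d e k : nat).

(** Degree less than [d] with coefficients in [J], the term of highest degree
    being split off first, so that arguments on leading coefficients are
    inductions on [d]. *)
Fixpoint polys_lt J d : set S :=
  if d is d'.+1 then
    [set s | exists a g, [/\ J a, polys_lt J d' g & s = a * x ^+ d' + g]]
  else [set 0].

Definition polys J : set S := [set s | exists d, polys_lt J d s].

Lemma subgroup_polys_lt J d : subgroup J -> subgroup (polys_lt J d).
Proof.
move=> gJ; elim: d => [|d gF] /=.
  by split=> [|_ _ -> ->] //=; rewrite subr0.
split=> [|_ _ [a [g [Ja Fg ->]]] [b [h [Jb Fh ->]]]].
  by exists 0, 0; split; [exact: subgroup0|exact: subgroup0|rewrite mul0r addr0].
exists (a - b), (g - h); split; [exact: subgroupB|exact: subgroupB|].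
by rewrite mulrBl opprD addrACA.
Qed.

Lemma polys_lt_ge J d e : J 0 -> (d <= e)%N -> polys_lt J d `<=` polys_lt J e.
Proof.
move=> J0 /subnK <-; elim: (e - d)%N => [|k IHk] //= s /IHk Fs.
by exists 0, s; split=> //; rewrite mul0r add0r.
Qed.

Lemma polys_ltS_sub J K d : J `<=` K -> polys_lt J d `<=` polys_lt K d.
Proof.
move=> sJK; elim: d => [|d IHd] //= _ [a [g [Ja Fg ->]]].
by exists a, g; split; [exact: sJK|exact: IHd|].
Qed.

Lemma polysS J K : J `<=` K -> polys J `<=` polys K.
Proof. by move=> sJK s [d Fs]; exists d; apply: (polys_ltS_sub sJK). Qed.

Lemma subgroup_polys J : subgroup J -> subgroup (polys J).
Proof.
move=> gJ; split=> [|g h [d Fg] [e Fh]]; first by exists 0%N.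
have J0 := subgroup0 gJ.
exists (maxn d e); apply: (subgroupB (subgroup_polys_lt _ gJ)).
  exact: (polys_lt_ge J0 (leq_maxl d e)).
exact: (polys_lt_ge J0 (leq_maxr d e)).
Qed.

Lemma polys_lt_min J d K : subgroup K ->
  (forall a k, (k < d)%N -> J a -> K (a * x ^+ k)) -> polys_lt J d `<=` K.
Proof.
move=> gK; elim: d => [|d IHd] JK /= => [_ ->|_ [a [g [Ja Fg ->]]]].
  exact: subgroup0.
apply: subgroupD => //; first exact: JK.
by apply: IHd => // b k lt_kd; apply: JK; apply: ltnW.
Qed.

Lemma polys_min J K : subgroup K ->
  (forall a k, J a -> K (a * x ^+ k)) -> polys J `<=` K.
Proof. by move=> gK JK s [d]; apply: polys_lt_min => // a k _; apply: JK. Qed.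

Lemma polys_lt_term J a d k : subgroup J -> J a -> (k < d)%N ->
  polys_lt J d (a * x ^+ k).
Proof.
move=> gJ Ja lt_kd; apply: (polys_lt_ge (subgroup0 gJ) lt_kd).
by exists a, 0; split=> //; [exact: (subgroup0 (subgroup_polys_lt _ gJ))|rewrite addr0].
Qed.

Lemma polys_lt_mulCl J K c d g : (forall a, J a -> K (c * a)) ->
  polys_lt J d g -> polys_lt K d (c * g).
Proof.
move=> JK; elim: d g => [|d IHd] g /= => [->|[a [h [Ja Fh ->]]]]; first exact: mulr0.
by exists (c * a), (c * h); split; [exact: JK|exact: IHd|rewrite mulrDr mulrA].
Qed.

Section VariableAction.
Context {J : set S} (gJ : subgroup J) (xJ : forall a, J a -> J (ad x a)).

Lemma polys_lt_mulXl d g : polys_lt J d g -> polys_lt J d.+1 (x * g).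
Proof.
move: g; have gF := subgroup_polys_lt d.+1 gJ.
apply: (polys_lt_min (subgroup_mull gF x)) => a k lt_kd Ja.
rewrite /= mulrA (mul_ad x a) mulrDl -mulrA -exprS.
by apply: (subgroupD gF); apply: polys_lt_term => //; [exact: xJ|exact: ltnW].
Qed.

Lemma polys_lt_mulXnl k d g : polys_lt J d g -> polys_lt J (k + d) (x ^+ k * g).
Proof.
move=> Fg; elim: k => [|k IHk]; first by rewrite mul1r.
by rewrite exprS -mulrA; apply: polys_lt_mulXl.
Qed.

(** Commuting [a] with one factor [x] at a time trades that factor for a
    derivative of [a], so every correction has lower degree. *)
Lemma polys_lt_comm k a : J a -> polys_lt J k (x ^+ k * a - a * x ^+ k).
Proof.
move=> Ja; elim: k => [|k IHk]; first by rewrite mul1r mulr1 subrr.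
have gF := subgroup_polys_lt k.+1 gJ.
rewrite (_ : _ - _ = x * (x ^+ k * a - a * x ^+ k) + ad x a * x ^+ k).
  apply: (subgroupD gF); first exact: polys_lt_mulXl.
  by apply: polys_lt_term => //; exact: xJ.
by rewrite /ad mulrBl mulrBr !exprS !mulrA subrKA.
Qed.

End VariableAction.

(** Moving a power of [x] to the right past a coefficient produces only iterated
    derivatives of this coefficient, and [V] contains them. *)
Lemma polys_mul U V W : subgroup V -> (forall a, V a -> V (ad x a)) -> subgroup W ->
  (forall a b, U a -> V b -> W (a * b)) ->
  forall g h, polys U g -> polys V h -> polys W (g * h).
Proof.
move=> gV xV gW UVW g h Ug [d Fh]; move: g Ug.
have gP := subgroup_polys gW.
apply: (polys_min (subgroup_mulr gP h)) => a k Ua.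
exists (k + d)%N; rewrite /= -mulrA; apply: (@polys_lt_mulCl V); first by move=> b; apply: UVW.
exact: polys_lt_mulXnl.
Qed.

Context {A : set S} (sA : subring_set A) (xA : forall a, A a -> A (ad x a)).

Let gA : subgroup A := subring_set_subgroup sA.

Lemma subring_set_polys : subring_set (polys A).
Proof.
split; first exact: subgroup_polys.
  exists 1%N, 1, 0; split=> //; first exact: subring_set1 sA.
  by rewrite mulr1 addr0.
by apply: polys_mul => //; apply: subring_setM.
Qed.

Lemma polys_term a k : A a -> polys A (a * x ^+ k).
Proof. by move=> Aa; exists k.+1; apply: polys_lt_term. Qed.

Lemma polysC a : A a -> polys A a.
Proof. by move=> /(@polys_term _ 0); rewrite mulr1. Qed.

Lemma polysXn k : polys A (x ^+ k).
Proof. by rewrite -[x ^+ k]mul1r; apply: polys_term; apply: subring_set1. Qed.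

Lemma polys_lt_mulCr J d g b : subgroup J -> (forall a c, J a -> A c -> J (a * c)) ->
  A b -> polys_lt J d g -> polys_lt J d (g * b).
Proof.
move=> gJ JA Ab; have gF := subgroup_polys_lt d gJ; move: g.
apply: (polys_lt_min (subgroup_mulr gF b)) => a k lt_kd Ja.
rewrite /= (_ : _ * b = a * b * x ^+ k + a * (x ^+ k * b - b * x ^+ k)).
  apply: (subgroupD gF).
    by apply: polys_lt_term => //; apply: JA.
  apply: (polys_lt_ge (subgroup0 gJ) (ltnW lt_kd)).
  apply: (@polys_lt_mulCl A); first by move=> c; apply: JA.
  exact: polys_lt_comm.
by rewrite mulrBr !mulrA addrC subrK.
Qed.

Lemma polys_lt_mulXnr k d g : polys_lt A d g -> polys_lt A (d + k) (g * x ^+ k).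
Proof.
move: g; have gF := subgroup_polys_lt (d + k) gA.
apply: (polys_lt_min (subgroup_mulr gF (x ^+ k))) => a e lt_ed Aa.
by rewrite /= -mulrA -exprD; apply: polys_lt_term => //; rewrite ltn_add2r.
Qed.

Lemma polys_lt_mul d e g h :
  polys_lt A d g -> polys_lt A e.+1 h -> polys_lt A (d + e) (g * h).
Proof.
move=> Fg Fh; move: g Fg; have gF := subgroup_polys_lt (d + e) gA.
apply: (polys_lt_min (subgroup_mulr gF h)) => a k lt_kd Aa.
rewrite /= -mulrA; apply: (@polys_lt_mulCl A) => [b|]; first exact: subring_setM.
apply: (polys_lt_ge (subgroup0 gA) _ (polys_lt_mulXnl gA xA k Fh)).
by rewrite addnS ltn_add2r.
Qed.

Section Derivation.
Context {y : S} (yA : forall a, A a -> A (ad y a)).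
Hypothesis yx : exists u v, [/\ A u, A v & ad y x = u * x + v].

(** The form of [ad y x] has two effects that make leading coefficients behave
    well under [ad y]: the degree in [x] does not grow, and the coefficient [w]
    produced at the top lies in [A], where an ideal absorbs it. *)
Lemma ad_expr k : exists w, A w /\ polys_lt A k (ad y (x ^+ k) - w * x ^+ k).
Proof.
elim: k => [|k [w [Aw Fw]]].
  exists 0; split; first exact: subgroup0 gA.
  by rewrite /ad mulr1 mul1r subrr mul0r subr0.
case: yx => u [v [Au Av yxE]]; have gF := subgroup_polys_lt k.+1 gA.
exists (u + w); split; first exact: (subgroupD gA).
rewrite (_ : _ - _ =
    v * x ^+ k + ad x w * x ^+ k + x * (ad y (x ^+ k) - w * x ^+ k)).
  apply: (subgroupD gF); last exact: polys_lt_mulXl.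
  by apply: (subgroupD gF); apply: polys_lt_term => //; apply: xA.
rewrite exprS adM yxE /(ad x w); set D := ad y _.
rewrite !(mulrDl, mulrBl) mulrBr !mulrA mulNr opprD.
rewrite [u * _ * _ + _]addrC addrACA addrK.
by rewrite -[RHS]addrA; congr (_ + _); rewrite [RHS]addrC subrKA.
Qed.

Lemma ad_polys_lt d g : polys_lt A d g -> polys_lt A d (ad y g).
Proof.
move: g; have gF := subgroup_polys_lt d gA.
apply: (polys_lt_min (subgroup_ad gF y)) => a k lt_kd Aa.
have [w [Aw Fw]] := ad_expr k.
rewrite /= adM -[ad y (x ^+ k)](subrK (w * x ^+ k)) mulrDr mulrA.
apply: (subgroupD gF); first by apply: polys_lt_term => //; apply: yA.
apply: (subgroupD gF); last by apply: polys_lt_term => //; apply: subring_setM.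
apply: (polys_lt_ge (subgroup0 gA) (ltnW lt_kd)).
by apply: polys_lt_mulCl Fw => b; apply: subring_setM.
Qed.

Lemma ad_polys J g : subgroup J -> (forall a c, J a -> A c -> J (a * c)) ->
  (forall a, J a -> J (ad y a)) -> polys J g -> polys J (ad y g).
Proof.
move=> gJ JA yJ; move: g; have gP := subgroup_polys gJ.
apply: (polys_min (subgroup_ad gP y)) => a k Ja.
rewrite /= adM; apply: (subgroupD gP).
  by exists k.+1; apply: polys_lt_term => //; apply: yJ.
exists k.+1; apply: (@polys_lt_mulCl A) => [c|]; first exact: JA.
by apply: ad_polys_lt; rewrite -[x ^+ k]mul1r; apply: polys_lt_term => //;
  apply: subring_set1.
Qed.

End Derivation.

(** * Leading coefficients of stable ideals *)

Context {Y : set S} (YA : forall y, Y y -> forall a, A a -> A (ad y a)).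
Hypothesis Yx : forall y, Y y -> exists u v, [/\ A u, A v & ad y x = u * x + v].

Lemma ad_polys_closed y b : Y y -> polys A b -> polys A (ad y b).
Proof.
move=> Yy; apply: ad_polys => //; [exact: YA|exact: Yx| |exact: YA].
exact: (subring_setM sA).
Qed.

Lemma stable_ideal_polys J :
  stable_ideal A (x |` Y) J -> stable_ideal (polys A) Y (polys J).
Proof.
move=> stJ; have gJ := stable_subgroup stJ.
split=> [||c j|c j Ac Jj|y j Yy].
- exact: polysS (stable_subset stJ).
- exact: subgroup_polys.
- by apply: polys_mul => //; [move=> a; apply: (stable_ad stJ); left|exact: (stable_mull stJ)].
- apply: polys_mul Jj Ac => // a b Ja Ab; exact: (stable_mulr stJ).
- apply: ad_polys => //; [exact: YA|exact: Yx|move=> a c Ja Ac|move=> a].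
    exact: (stable_mulr stJ).
  by apply: (stable_ad stJ); right.
Qed.

(** Leading coefficients in degree [d] of the elements of [P], and [0]: the
    coefficient [a] may vanish. *)
Definition lead P d : set S :=
  [set a | A a /\ exists f, P f /\ polys_lt A d (f - a * x ^+ d)].

Lemma lead_mulr d f a c : A a -> A c -> polys_lt A d (f - a * x ^+ d) ->
  polys_lt A d (f * c - a * c * x ^+ d).
Proof.
move=> Aa Ac Ff; have gF := subgroup_polys_lt d gA.
rewrite (_ : _ - _ = (f - a * x ^+ d) * c + a * (x ^+ d * c - c * x ^+ d)).
  apply: (subgroupD gF); first by apply: polys_lt_mulCr => //; exact: subring_setM.
  by apply: (@polys_lt_mulCl A) => [b|]; [exact: subring_setM|exact: polys_lt_comm].
by rewrite mulrBl mulrBr !mulrA subrKA.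
Qed.

Lemma lead_mulXnl k d f a : A a -> polys_lt A d (f - a * x ^+ d) ->
  polys_lt A (k + d) (x ^+ k * f - a * x ^+ (k + d)).
Proof.
move=> Aa Ff; have gF := subgroup_polys_lt (k + d) gA.
rewrite (_ : _ - _ = x ^+ k * (f - a * x ^+ d) + (x ^+ k * a - a * x ^+ k) * x ^+ d).
  apply: (subgroupD gF); first exact: polys_lt_mulXnl.
  by apply: polys_lt_mulXnr; apply: polys_lt_comm.
by rewrite mulrBl mulrBr exprD !mulrA subrKA.
Qed.

(** [ad y f] has the coefficient [ad y a + a * w] in degree [d], where [w] comes
    from [ad_expr]; since [P] contains [f * w], whose coefficient is [a * w], the
    difference is an element of [P] with coefficient [ad y a]. *)
Lemma lead_ad P d y a : stable_ideal (polys A) Y P ->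
  (forall f, P f -> P (ad y f)) -> (forall a, A a -> A (ad y a)) ->
  (exists u v, [/\ A u, A v & ad y x = u * x + v]) ->
  lead P d a -> lead P d (ad y a).
Proof.
move=> stP yP yA yx [Aa [f [Pf Ff]]]; split; first exact: yA.
have gF := subgroup_polys_lt d gA.
have [w [Aw Fw]] := ad_expr yx d.
exists (ad y f - f * w); split.
  apply: (subgroupB (stable_subgroup stP)); first exact: yP.
  by apply: (stable_mulr stP) => //; apply: polysC.
rewrite (_ : _ - _ = ad y (f - a * x ^+ d) + a * (ad y (x ^+ d) - w * x ^+ d)
  - (f * w - a * w * x ^+ d)).
  apply: (subgroupB gF); last exact: lead_mulr.
  apply: (subgroupD gF); first exact: ad_polys_lt.
  by apply: (@polys_lt_mulCl A) => // b; apply: subring_setM.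
rewrite adB adM mulrBr !mulrA opprB -[RHS]addrA (subrKA (a * w * x ^+ d)) opprD !addrA subrK.
exact: addrAC.
Qed.

Lemma stable_ideal_lead P d :
  stable_ideal (polys A) Y P -> stable_ideal A (x |` Y) (lead P d).
Proof.
move=> stP; have gP := stable_subgroup stP; have gF := subgroup_polys_lt d gA.
split.
- by move=> a [].
- split=> [|a b [Aa [f [Pf Ff]]] [Ab [h [Ph Fh]]]].
    split; first exact: subgroup0 gA.
    by exists 0; rewrite mul0r subrr; split; [exact: subgroup0 gP|exact: subgroup0 gF].
  split; first exact: subgroupB.
  exists (f - h); split; first exact: subgroupB.
  rewrite mulrBl [- (_ - _)]opprD addrACA -opprD.
  exact: (subgroupB gF).
- move=> c a Ac [Aa [f [Pf Ff]]]; split; first exact: subring_setM.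
  exists (c * f); split; first by apply: (stable_mull stP) => //; apply: polysC.
  by rewrite -mulrA -mulrBr; apply: polys_lt_mulCl Ff => b; apply: subring_setM.
- move=> c a Ac [Aa [f [Pf Ff]]]; split; first exact: subring_setM.
  exists (f * c); split; first by apply: (stable_mulr stP) => //; apply: polysC.
  exact: lead_mulr.
- have Px f : P f -> P (ad x f).
    move=> Pf; have Ax : polys A x := polysXn 1.
    by apply: (subgroupB gP); [apply: (stable_mull stP)|apply: (stable_mulr stP)].
  have xx : exists u v, [/\ A u, A v & ad x x = u * x + v].
    have A0 := subgroup0 gA.
    by exists 0, 0; rewrite /ad subrr mul0r addr0.
  move=> y a [->|Yy]; first exact: lead_ad.
  by apply: lead_ad (YA Yy) (Yx Yy) => // f; apply: (stable_ad stP).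
Qed.

(** * Coefficients of a polynomial *)

Hypothesis free : forall a d, A a -> polys_lt A d (a * x ^+ d) -> a = 0.

(** Stands for the polynomials of degree less than [d] over the quotient of [A]
    by [J], without forming this quotient. *)
Definition polys_lt_mod J d : set S := setadd (polys_lt A d) (polys J).

(** If [q] has coefficients in [J] and exceeds degree [d], freeness kills its
    top coefficient; once the degree of [q] is at most [d], freeness gives that
    [a] is the coefficient of [q] in degree [d]. *)
Lemma polys_lt_mod_lead J a d : subgroup J -> J `<=` A -> A a ->
  polys_lt_mod J d (a * x ^+ d) -> J a.
Proof.
move=> gJ sJA Aa [g [q [Fg [e Fq] axE]]].
have A0 := subgroup0 gA.
elim: e q Fq axE => [|e IHe] q Fq axE.
  rewrite (@free a d) //; first exact: subgroup0.
  by move: Fq axE => /= -> ->; rewrite addr0.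
have [lt_ed|] := ltnP e d.
  rewrite (@free a d) //; first exact: subgroup0.
  rewrite axE; apply: (subgroupD (subgroup_polys_lt d gA)) => //.
  exact: (polys_lt_ge A0 lt_ed (polys_ltS_sub sJA Fq)).
case: Fq => c [r [Jc Fr qE]]; have FAr := polys_ltS_sub sJA Fr.
have Ac := sJA _ Jc; have gF := subgroup_polys_lt e gA.
rewrite leq_eqVlt => /orP[/eqP dE|lt_de].
  rewrite -[a](subrK c) (@free (a - c) d) ?add0r //; first exact: (subgroupB gA).
  rewrite mulrBl axE qE dE addrCA [c * _ + _]addrC addrK.
  by apply: (subgroupD gF) => //; rewrite -dE.
have c0 : c = 0.
  apply: (@free c e) => //.
  rewrite (_ : _ * _ = a * x ^+ d - g - r); last first.
    by rewrite axE qE [g + _]addrC addrK addrK.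
  apply: (subgroupB gF) => //; apply: (subgroupB gF); first exact: polys_lt_term.
  exact: (polys_lt_ge A0 (ltnW lt_de)).
by apply: (IHe r) => //; rewrite axE qE c0 mul0r add0r.
Qed.

(** By freeness, a polynomial has the same coefficients in all the [polys (T k)]. *)
Lemma polys_bigcap (T : nat -> set S) g :
  (forall k, subgroup (T k)) -> (forall k, T k `<=` A) ->
  (forall k, polys (T k) g) -> polys (\bigcap_k T k) g.
Proof.
move=> gT sTA Tg; have [d Fg] : polys A g by apply: polysS (Tg 0%N).
exists d; elim: d g Fg Tg => [|d IHd] g //= [a [h [Aa Fh gE]]] Tg.
have Ta k : T k a.
  apply: (polys_lt_mod_lead (gT k) (sTA k) Aa); exists (- h), g; split=> //.
    exact: (subgroupN (subgroup_polys_lt d gA)).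
  by rewrite gE addrC addrK.
exists a, h; split=> //; apply: IHd => // k.
rewrite (_ : h = g - a * x ^+ d); last by rewrite gE addrC addKr.
apply: (subgroupB (subgroup_polys (gT k))) => //.
by exists d.+1; apply: polys_lt_term.
Qed.

Lemma omega_in_polys J : stable_ideal A (x |` Y) J ->
  omega_in (polys A) (polys J) `<=` polys (omega_in A J).
Proof.
move=> stJ g Og; have nA z b : (x |` Y) z -> A b -> A (ad z b).
  by move=> [->|Yz]; [exact: xA|exact: YA].
have stk := stable_ideal_pow sA nA stJ.
apply: polys_bigcap => k; [exact: stable_subgroup (stk k)|exact: stable_subset (stk k)|].
have {Og} := Og k Logic.I; elim: k g => [|k IHk] g //=.
have gJk := stable_subgroup (stk k.+1).
apply: (ideal_mul_min (subgroup_polys gJk)) => a b /IHk.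
apply: polys_mul => //; first exact: stable_subgroup stJ.
  by move=> c; apply: (stable_ad stJ); left.
by move=> c c'; apply: ideal_mul_mem.
Qed.

Lemma iter_omega_in_polys k J : stable_ideal A (x |` Y) J ->
  iter k (omega_in (polys A)) (polys J) `<=` polys (iter k (omega_in A) J).
Proof.
move=> stJ; have nA z b : (x |` Y) z -> A b -> A (ad z b).
  by move=> [->|Yz]; [exact: xA|exact: YA].
have stk i := stable_ideal_iter_omega i sA nA stJ.
elim: k => [|k IHk] //=; apply: subset_trans (omega_in_polys (stk k)).
exact: (@iter_omega_inS _ _ _ _ 1 IHk).
Qed.


(** * Powers of a maximal stable ideal *)

Section MaximalStableIdeal.
Context {P : set S} (stP : stable_ideal (polys A) Y P) (P1 : ~ P 1).
Hypothesis maxP : forall K, stable_ideal (polys A) Y K -> ~ K 1 ->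
  P `<=` K -> K `<=` P.

Let B := polys A.
Let J := P `&` A.
Let Q := polys J.

Let sB : subring_set B := subring_set_polys.
Let gB : subgroup B := subring_set_subgroup sB.
Let gP : subgroup P := stable_subgroup stP.

Lemma stable_ideal_restrict : stable_ideal A (x |` Y) J.
Proof.
split.
- by move=> a [].
- split=> [|a b [Pa Aa] [Pb Ab]]; first by split; [exact: subgroup0 gP|exact: subgroup0 gA].
  by split; [exact: (subgroupB gP)|exact: (subgroupB gA)].
- move=> c a Ac [Pa Aa]; split; last exact: (subring_setM sA).
  by apply: (stable_mull stP) => //; apply: polysC.
- move=> c a Ac [Pa Aa]; split; last exact: (subring_setM sA).
  by apply: (stable_mulr stP) => //; apply: polysC.
- move=> y a [->|Yy] [Pa Aa]; split; [|exact: xA| |exact: YA].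
    have Bx : B x := polysXn 1.
    by apply: (subgroupB gP); [apply: (stable_mull stP)|apply: (stable_mulr stP)].
  exact: (stable_ad stP).
Qed.

Let stJ := stable_ideal_restrict.
Let gJ : subgroup J := stable_subgroup stJ.
Let sJA : J `<=` A := stable_subset stJ.
Let stQ : stable_ideal B Y Q := stable_ideal_polys stJ.
Let gQ : subgroup Q := stable_subgroup stQ.

Lemma polys_restrict_sub : Q `<=` P.
Proof.
apply: (polys_min gP) => a k [Pa _]; apply: (stable_mulr stP) => //.
exact: polysXn.
Qed.

Lemma stable_ideal_colon L : stable_ideal A (x |` Y) L ->
  stable_ideal A (x |` Y) [set a | A a /\ forall l, L l -> J (a * l)].
Proof.
move=> stL; split.
- by move=> a [].
- split=> [|a b [Aa aL] [Ab bL]].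
    split=> [|l _]; first exact: (subgroup0 gA).
    by rewrite mul0r; exact: (subgroup0 gJ).
  split=> [|l Ll]; first exact: (subgroupB gA).
  by rewrite mulrBl; apply: (subgroupB gJ); [exact: aL|exact: bL].
- move=> c a Ac [Aa aL]; split=> [|l Ll]; first exact: (subring_setM sA).
  by rewrite -mulrA; apply: (stable_mull stJ) => //; exact: aL.
- move=> c a Ac [Aa aL]; split=> [|l Ll]; first exact: (subring_setM sA).
  by rewrite -mulrA; apply: aL; apply: (stable_mull stL).
- move=> y a Zy [Aa aL]; split=> [|l Ll]; first by case: Zy => [->|Yy]; [exact: xA|exact: YA].
  apply: (@subgroup_addr _ _ gJ (a * ad y l)); last first.
    by rewrite -adM; apply: (stable_ad stJ) => //; exact: aL.
  by apply: aL; apply: (stable_ad stL).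
Qed.

(** The elements multiplied into [J] by [L] form a stable ideal [K].  If neither
    [K] nor [L] were inside [J], maximality would give [1] in both [K[x] + P] and
    [L[x] + P]; the product of the two decompositions of [1] lies in [P], because
    [K * L] lies in [J]. *)
Lemma restrict_prime L : stable_ideal A (x |` Y) L -> ~ (L `<=` J) ->
  forall a, A a -> (forall l, L l -> J (a * l)) -> J a.
Proof.
move=> stL nLJ; set K := [set a | A a /\ forall l, L l -> J (a * l)].
suff sKJ : K `<=` J by move=> a Aa aL; apply: sKJ.
have stK : stable_ideal A (x |` Y) K := stable_ideal_colon stL.
apply: contrapT => nKJ.
have one H : stable_ideal A (x |` Y) H -> ~ (H `<=` J) -> setadd (polys H) P 1.
  move=> stH nHJ; have stPH := stable_ideal_polys stH.
  have P0 := subgroup0 gP.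
  apply: contrapT => n1; apply: nHJ => a Ha; have Aa := stable_subset stH Ha.
  split=> //; apply: (maxP (stable_ideal_add gB stPH stP) n1).
    exact: (setadd_subr (stable_ideal0 stPH)).
  apply: (setadd_subl P0); exists 1%N, a, 0.
  by rewrite mulr1 addr0.
have [u [p [Ku Pp oneK]]] := one K stK nKJ.
have [v [q [Lv Pq oneL]]] := one L stL nLJ.
apply: P1; rewrite -[1]mulr1 {1}oneK oneL mulrDl mulrDr.
have Bv : B v := stable_subset (stable_ideal_polys stL) Lv.
have Bu : B u := stable_subset (stable_ideal_polys stK) Ku.
have Bq : B q := stable_subset stP Pq.
apply: (subgroupD gP); last by apply: (stable_mulr stP) => //; apply: (subgroupD gB).
apply: (subgroupD gP); last exact: (stable_mull stP).
apply: polys_restrict_sub; apply: polys_mul Ku Lv => //.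
- exact: stable_subgroup stL.
- by move=> a; apply: (stable_ad stL); left.
- by move=> a b [_ aL] /aL.
Qed.


Lemma subgroup_polys_lt_mod d : subgroup (polys_lt_mod J d).
Proof. by apply: subgroup_setadd; first exact: subgroup_polys_lt. Qed.

Lemma polys_lt_sub_mod d : polys_lt A d `<=` polys_lt_mod J d.
Proof. exact: setadd_subl (subgroup0 gQ). Qed.

Lemma polys_sub_mod d : Q `<=` polys_lt_mod J d.
Proof. exact: setadd_subr (subgroup0 (subgroup_polys_lt d gA)). Qed.

Lemma polys_lt_mod_ge d e : (d <= e)%N -> polys_lt_mod J d `<=` polys_lt_mod J e.
Proof.
move=> le_de _ [g [q [Fg Qq ->]]]; exists g, q; split=> //.
exact: (polys_lt_ge (subgroup0 gA) le_de).
Qed.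

Lemma polys_lt_mod_mulr d g a : A a -> polys_lt_mod J d g -> polys_lt_mod J d (g * a).
Proof.
move=> Aa [h [q [Fh Qq ->]]]; exists (h * a), (q * a); split; last exact: mulrDl.
  by apply: polys_lt_mulCr => //; exact: (subring_setM sA).
by apply: (stable_mulr stQ) => //; apply: polysC.
Qed.

Section MinimalDegree.
Context {m : nat} (m_gt0 : (0 < m)%N).
Hypothesis minm : P `&` polys_lt A m `<=` Q.

Let L := lead P m.

Hypothesis nLJ : ~ (L `<=` J).

Let stL : stable_ideal A (x |` Y) L := stable_ideal_lead m stP.
Let sLA : L `<=` A := stable_subset stL.
Let LJ := restrict_prime stL nLJ.

Let Pmin := P `&` polys_lt A m.+1.

Lemma polys_lt_lead f l : A l -> polys_lt A m (f - l * x ^+ m) -> polys_lt A m.+1 f.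
Proof. by move=> Al Ff; exists l, (f - l * x ^+ m); split; rewrite // addrC subrK. Qed.

Lemma Pmin_mulr f a : Pmin f -> A a -> Pmin (f * a).
Proof.
move=> [Pf Ff] Aa; split; first by apply: (stable_mulr stP) => //; apply: polysC.
by apply: polys_lt_mulCr => //; exact: (subring_setM sA).
Qed.

Let mul_min (K : set S) := setadd (ideal_mul K Pmin) Q.

Lemma subgroup_mul_min K : subgroup K -> subgroup (mul_min K).
Proof. by move=> gK; apply: subgroup_setadd => //; apply: subgroup_ideal_mul. Qed.

Lemma mul_min_mulr K s a : subgroup K -> mul_min K s -> L a -> mul_min K (s * a).
Proof.
move=> gK [r [q [KPr Qq ->]]] La; have Aa := sLA La.
exists (r * a), (q * a); split; last exact: mulrDl.
  move: r KPr; have gKP := @subgroup_ideal_mul _ K Pmin gK.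
  apply: (ideal_mul_min (subgroup_mulr gKP a)) => k f Kk Pf /=.
  by rewrite -mulrA; apply: ideal_mul_mem => //; apply: Pmin_mulr.
by apply: (stable_mulr stQ) => //; apply: polysC.
Qed.

(** Division with remainder: if [a] is the leading coefficient of [b] in degree
    [d] and [f] in [P] has degree [m] and leading coefficient [l], subtracting
    [x ^+ (d - m) * a * f] from [b * l] lowers the degree.  Below degree [m], the
    elements of [P] are in [Q]. *)
Lemma division b : P b -> saturation L (mul_min B) b.
Proof.
move=> Pb; have [d Fb] := stable_subset stP Pb.
have gTB := subgroup_mul_min gB.
elim: d b Pb Fb => [|d IHd] b Pb Fb.
  by rewrite (Fb : b = 0); apply: saturation_base; exact: (subgroup0 gTB).
have [le_md|lt_dm] := leqP m d; last first.
  apply: saturation_base; apply: setadd_subr; first exact: (subgroup0 (@subgroup_ideal_mul _ B Pmin gB)).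
  by apply: minm; split=> //; apply: (polys_lt_ge (subgroup0 gA) lt_dm).
case: Fb => a [g [Aa Fg bE]]; apply: saturation_step => l [Al [f [Pf Ff]]].
have gT : subgroup (saturation L (mul_min B)).
  by apply: subgroup_saturation => // s c; apply: mul_min_mulr.
have gF := subgroup_polys_lt d gA.
have Bc : B (x ^+ (d - m) * a) by apply: (subring_setM sB); [exact: polysXn|exact: polysC].
rewrite -[b * l](subrK (x ^+ (d - m) * a * f)); apply: (subgroupD gT).
  apply: IHd; first apply: (subgroupB gP).
  - by apply: (stable_mulr stP) => //; apply: polysC.
  - exact: (stable_mull stP).
  - rewrite -(subrK (a * l * x ^+ d) (b * l)) -addrA; apply: (subgroupD gF).
      by apply: lead_mulr => //; rewrite bE addrC addKr.
    rewrite -opprB; apply: (subgroupN gF); rewrite -mulrA.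
    have -> : x ^+ d = x ^+ (d - m + m) by rewrite subnK.
    rewrite -{1}(subnK le_md); apply: lead_mulXnl; first exact: (subring_setM sA).
    rewrite -mulrA -mulrBr; apply: (@polys_lt_mulCl A) Ff => c.
    exact: (subring_setM sA).
apply: saturation_base; apply: setadd_subl; first exact: (subgroup0 gQ).
by apply: ideal_mul_mem => //; split=> //; apply: polys_lt_lead Ff.
Qed.

(** The dividing is done on the last factor of each product, so that the
    remaining factors stay in the [k]-th power. *)
Lemma saturation_pow k g :
  pow_in B P k.+1 g -> saturation L (mul_min (pow_in B P k)) g.
Proof.
set K := pow_in B P k.
have stK : stable_ideal B Y K := stable_ideal_pow sB ad_polys_closed stP k.
have gK := stable_subgroup stK; have gTK := subgroup_mul_min gK.
move: g; apply: ideal_mul_min.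
  by apply: subgroup_saturation => // s c; apply: mul_min_mulr.
move=> a b Ka /division; apply: saturation_mull => _ [r [q [BPr Qq ->]]].
exists (a * r), (a * q); split; last exact: mulrDr; last first.
  by apply: (stable_mull stQ) => //; apply: (stable_subset stK).
move: r BPr; have gKP := @subgroup_ideal_mul _ K Pmin gK.
apply: (ideal_mul_min (subgroup_mull gKP a)) => c f Bc Pf /=.
by rewrite mulrA; apply: ideal_mul_mem => //; apply: (stable_mulr stK).
Qed.

(** By [restrict_prime], applied to the coefficients of [g] from the top one
    down. *)
Lemma polys_torsion_free g : B g -> (forall l, L l -> Q (g * l)) -> Q g.
Proof.
case=> d; elim: d g => [|d IHd] g; first by move=> /= -> _; exact: (subgroup0 gQ).
move=> [a [h [Aa Fh gE]]] gL; have gV := subgroup_polys_lt_mod d.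
have Ja : J a.
  apply: LJ => // l Ll; have Al := sLA Ll.
  apply: (polys_lt_mod_lead gJ sJA (d := d)); first exact: (subring_setM sA).
  rewrite -[_ * _](subKr (g * l)); apply: (subgroupB gV).
    by apply: polys_sub_mod; apply: gL.
  by apply: polys_lt_sub_mod; apply: lead_mulr => //; rewrite gE addrC addKr.
have Qa : Q (a * x ^+ d) by exists d.+1; apply: polys_lt_term.
rewrite gE; apply: (subgroupD gQ) => //; apply: IHd => // l Ll.
rewrite (_ : h = g - a * x ^+ d); last by rewrite gE addrC addKr.
rewrite mulrBl; apply: (subgroupB gQ); first exact: gL.
by apply: (stable_mulr stQ) => //; apply: polysC; apply: sLA.
Qed.

(** If [c] is the coefficient of [p] in degree [e], then [c * l] is the
    coefficient of [p * f] in degree [e + m]; it lies in [J] for all [l] in [L],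
    so [c] lies in [J]. *)
Lemma polys_lt_mod_cancel e p : (forall l f, A l -> P f ->
    polys_lt A m (f - l * x ^+ m) -> polys_lt_mod J (e + m) (p * f)) ->
  polys_lt_mod J e.+1 p -> polys_lt_mod J e p.
Proof.
move=> pPmin [_ [q [[c [g [Ac Fg ->]]] Qq pE]]].
have Jc : J c.
  apply: LJ => // l [Al [f [Pf Ff]]].
  apply: (polys_lt_mod_lead gJ sJA (d := e + m)); first exact: (subring_setM sA).
  have gV := subgroup_polys_lt_mod (e + m).
  rewrite (_ : _ * _ =
      p * f - (g * f + q * f) - c * (x ^+ e * f - l * x ^+ (e + m))).
    apply: (subgroupB gV).
      apply: (subgroupB gV); first exact: pPmin Ff.
      apply: (subgroupD gV).
        by apply/polys_lt_sub_mod/polys_lt_mul => //; apply: polys_lt_lead Ff.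
      by apply: polys_sub_mod; apply: (stable_mulr stQ) => //; apply: (stable_subset stP).
    apply: polys_lt_sub_mod; apply: (@polys_lt_mulCl A).
      by move=> b; apply: (subring_setM sA).
    exact: lead_mulXnl.
  by rewrite pE mulrDl (mulrDl _ g) -(addrA _ (g * f)) addrK mulrBr !mulrA subKr.
exists g, (c * x ^+ e + q); split=> //; last by rewrite pE addrAC addrC.
by apply: (subgroupD gQ) => //; exists e.+1; apply: polys_lt_term.
Qed.

Lemma polys_lt_mod_descend k p : B p -> (forall l f, A l -> P f ->
    polys_lt A m (f - l * x ^+ m) -> polys_lt_mod J (k + m) (p * f)) ->
  polys_lt_mod J k p.
Proof.
move=> [d Fp] pPmin; have {Fp} := polys_lt_sub_mod Fp.
elim: d => [|d IHd] Vp; first exact: polys_lt_mod_ge Vp.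
have [le_kd|lt_dk] := leqP k d; last exact: polys_lt_mod_ge Vp.
apply: IHd; apply: polys_lt_mod_cancel Vp => l f Al Pf Ff.
by apply: (@polys_lt_mod_ge (k + m)); [rewrite leq_add2r|exact: pPmin Ff].
Qed.

(** If [f] and [h] are elements of [P] of degree at most [m], with coefficients
    [c] and [l] in degree [m], then [f * l - c * h] is an element of [P] of
    smaller degree, so it lies in [Q].  Thus a sum of products [a * f] multiplied
    by [l] becomes a single product by [h], and the other factor, the sum of the
    [a * c], depends neither on [l] nor on [h]. *)
Lemma exchange K s : stable_ideal B Y K -> ideal_mul K Pmin s ->
  exists p, K p /\ forall l h, A l -> P h -> polys_lt A m (h - l * x ^+ m) ->
    Q (s * l - p * h).
Proof.
move=> stK; have gK := stable_subgroup stK.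
move: s; apply: ideal_mul_min.
  split=> [|s t [p [Kp sp]] [r [Kr tr]]].
    exists 0; split=> [|l h *]; first exact: (subgroup0 gK).
    by rewrite !mul0r subrr; exact: (subgroup0 gQ).
  exists (p - r); split=> [|l h Al Ph Fh]; first exact: (subgroupB gK).
  rewrite !mulrBl [- (_ - _)]opprD addrACA -opprD.
  by apply: (subgroupB gQ); [exact: sp|exact: tr].
move=> a f Ka [Pf [c [g [Ac Fg fE]]]]; exists (a * c); split.
  by apply: (stable_mulr stK) => //; apply: polysC.
move=> l h Al Ph Fh; rewrite -!mulrA -mulrBr.
have Ba := stable_subset stK Ka; apply: (stable_mull stQ) => //.
have gF := subgroup_polys_lt m gA; apply: minm; split.
  apply: (subgroupB gP); first by apply: (stable_mulr stP) => //; apply: polysC.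
  by apply: (stable_mull stP) => //; apply: polysC.
rewrite (_ : _ - _ = (f * l - c * l * x ^+ m) - c * (h - l * x ^+ m)).
  apply: (subgroupB gF).
    by apply: lead_mulr => //; rewrite fE addrC addKr.
  by apply: (@polys_lt_mulCl A) Fh => b; apply: (subring_setM sA).
by rewrite mulrBr !mulrA opprB subrKA.
Qed.

(** Each further factor from [P] raises the least degree modulo [Q] by at least
    [m], hence by at least one: an element [g] of the next power is exchanged
    for a product [p * h], whose degree is that of [p] increased by [m]. *)
Lemma pow_polys_lt_mod k p : pow_in B P k p -> polys_lt_mod J k p -> Q p.
Proof.
have stK i : stable_ideal B Y (pow_in B P i) := stable_ideal_pow sB ad_polys_closed stP i.
elim: k p => [|k IHk] g; first by move=> _ [_ [q [-> Qq ->]]]; rewrite add0r.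
move=> Kg Vg; have Bg := stable_subset (stK _) Kg.
have {Kg} := saturation_pow Kg; move=> sg; elim: sg Bg Vg => {}g; last first.
  move=> _ IHg Bg Vg; apply: polys_torsion_free => // l Ll; have Al := sLA Ll.
  by apply: IHg => //; [apply: (subring_setM sB) => //; apply: polysC
                       |apply: polys_lt_mod_mulr].
move=> [s [q [/(exchange (stK k)) [p [Kp sp]] Qq gE]]] Bg Vg.
have gV := subgroup_polys_lt_mod (k + m).
have ql l : A l -> Q (q * l) by move=> Al; apply: (stable_mulr stQ) => //; apply: polysC.
have Qp : Q p.
  apply: IHk => //; apply: polys_lt_mod_descend; first exact: stable_subset (stK k) _ Kp.
  move=> l h Al Ph Fh.
  rewrite (_ : p * h = g * l - q * l - (s * l - p * h)); last first.
    by rewrite gE mulrDl addrK subKr.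
  apply: (subgroupB gV); last by apply: polys_sub_mod; exact: sp Fh.
  apply: (subgroupB gV); last by apply: polys_sub_mod; exact: ql.
  apply: (@polys_lt_mod_ge k.+1); last exact: polys_lt_mod_mulr.
  by rewrite -addn1 leq_add2l.
apply: polys_torsion_free => // l [Al [h [Ph Fh]]].
rewrite gE mulrDl -[s * l](subrK (p * h)); apply: (subgroupD gQ); last exact: ql.
apply: (subgroupD gQ); first exact: sp Fh.
by apply: (stable_mulr stQ) => //; apply: (stable_subset stP).
Qed.

End MinimalDegree.

Lemma omega_in_maximal : omega_in B P `<=` Q.
Proof.
have [sPQ g /(_ 1%N Logic.I) Pg|nPQ] := pselect (P `<=` Q).
  apply: sPQ; move: Pg; apply: (ideal_mul_min gP) => a b Ba Pb.
  exact: (stable_mull stP).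
have ex_d : exists d, `[< ~ (P `&` polys_lt A d `<=` Q) >].
  apply: contrapT => nd; apply: nPQ => g Pg; have [d Fg] := stable_subset stP Pg.
  apply: contrapT => nQg; apply: nd; exists d; apply/asboolP => sQ.
  by apply: nQg; apply: sQ.
have /= [d /asboolP nQd mind] := ex_minnP ex_d.
case: d => [|m] in nQd mind.
  by case: nQd => g [_ ->]; exact: (subgroup0 gQ).
have minm : P `&` polys_lt A m `<=` Q.
  apply: contrapT => /asboolP/mind; by rewrite ltnn.
(* An element of degree [0] of [P] lies in [A], hence in [J]. *)
have m_gt0 : (0 < m)%N.
  case: m nQd {mind minm} => // nQ1; case: nQ1 => g [Pg [a [_ [Aa -> gE]]]].
  move: gE Pg; rewrite mulr1 addr0 => -> Pa; exists 1%N, a, 0.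
  by split=> //; rewrite mulr1 addr0.
have nLJ : ~ (lead P m `<=` J).
  move=> sLJ; apply: nQd => f [Pf [c [g [Ac Fg fE]]]].
  have Qc : Q (c * x ^+ m).
    exists m.+1; apply: polys_lt_term => //; apply: sLJ; split=> //; exists f.
    by split; rewrite // fE addrC addKr.
  rewrite fE; apply: (subgroupD gQ) => //; apply: minm; split=> //.
  rewrite (_ : g = f - c * x ^+ m); last by rewrite fE addrC addKr.
  by apply: (subgroupB gP) => //; apply: polys_restrict_sub.
move=> g Og; have [d Fg] := Og 0%N Logic.I.
by apply: (pow_polys_lt_mod m_gt0 minm nLJ (Og d Logic.I)); apply: polys_lt_sub_mod.
Qed.

End MaximalStableIdeal.

Lemma iter_omega_in_extension k :
  (forall J, stable_ideal A (x |` Y) J -> ~ J 1 ->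
    iter k (omega_in A) J `<=` [set 0]) ->
  forall I, stable_ideal (polys A) Y I -> ~ I 1 ->
    iter k.+1 (omega_in (polys A)) I `<=` [set 0].
Proof.
move=> IHA I stI I1.
have [P [stP P1 sIP maxP]] := exists_maximal_stable_ideal stI I1.
have stJ := stable_ideal_restrict stP.
have sIJ : omega_in (polys A) I `<=` polys (P `&` A).
  apply: subset_trans (omega_in_maximal stP P1 maxP).
  exact: (@iter_omega_inS _ _ _ _ 1).
have J0 : iter k (omega_in A) (P `&` A) `<=` [set 0].
  by apply: IHA stJ _; case.
rewrite iterSr => s /(iter_omega_inS sIJ) /(iter_omega_in_polys stJ) /(polysS J0) [d].
by apply: (@polys_lt_min _ _ [set 0]) => [|a i _ /= ->];
  [split=> //= a b -> ->; rewrite subr0|rewrite mul0r].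
Qed.

End Polynomials.

(** * The tower of differential polynomial rings *)

Lemma subring_setP (S : pzRingType) (A : set S) :
  subring_closed (mem A) <-> subring_set A.
Proof.
split=> [[A1 AB AM]|[[_ AB] A1 AM]]; split.
- split=> [|a b Aa Ab]; last by apply: set_mem; apply: AB; apply: mem_set.
  by rewrite -(subrr 1); apply: set_mem; exact: AB.
- exact: set_mem.
- by move=> a b Aa Ab; apply: set_mem; apply: AM; apply: mem_set.
- exact: mem_set.
- by move=> a b /set_mem Aa /set_mem Ab; apply: mem_set; apply: AB.
- by move=> a b /set_mem Aa /set_mem Ab; apply: mem_set; apply: AM.
Qed.

Lemma subring_set_smallest (S : pzRingType) (G : set S) :
  subring_set (smallest (fun A : set S => subring_closed (mem A)) G).
Proof.
split.
- split=> [A [/subring_setP sA _]|a b Ra Rb A sA].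
    exact: (subgroup0 (subring_set_subgroup sA)).
  have [/subring_setP sA' _] := sA.
  by apply: (subgroupB (subring_set_subgroup sA')); [exact: Ra|exact: Rb].
- by move=> A [/subring_setP sA _]; apply: (subring_set1 sA).
- move=> a b Ra Rb A sA; have [/subring_setP sA' _] := sA.
  by apply: (subring_setM sA'); [exact: Ra|exact: Rb].
Qed.

Lemma polys_ltP (S : pzRingType) (y : S) (J : set S) (m : nat) s :
  polys_lt y J m s <->
  exists a : 'I_m -> S, (forall k, a k \in J) /\ s = \sum_(k < m) a k * y ^+ k.
Proof.
elim: m s => [|m IHm] s /=.
  split=> [->|[a [_ ->]]]; last by rewrite big_ord0.
  by exists (fun=> 0); split=> [[]|] //; rewrite big_ord0.
split=> [[c [g [Jc /IHm [a [Ja ->]] ->]]]|[a [Ja ->]]].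
  exists (fun k : 'I_m.+1 => if unlift ord_max k is Some i then a i else c).
  split=> [k|]; first by case: unliftP => // _; exact: mem_set.
  rewrite big_ord_recr /= unlift_none addrC; congr (_ + _).
  apply: eq_bigr => i _; rewrite (_ : widen_ord _ i = lift ord_max i) ?liftK //.
    exact/val_inj/esym/lift_max.
exists (a ord_max), (\sum_(k < m) a (widen_ord (leqnSn m) k) * y ^+ k).
split; first exact: set_mem.
  by apply/IHm; exists (fun k => a (widen_ord (leqnSn m) k)).
by rewrite big_ord_recr addrC.
Qed.

Section Tower.
Context {n : nat} {R S : pzRingType} {iota : {rmorphism R -> S}}.
Context {x : 'I_n -> S} {delta : 'I_n -> S -> S}.
Hypothesis hS : iterated_diff_poly_ring iota x delta.

Local Notation R_ := (subring_upto iota x).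

Lemma subring_set_upto i : subring_set (R_ i).
Proof. exact: subring_set_smallest. Qed.

Lemma upto0 : R_ 0 = range iota.
Proof.
rewrite /subring_upto; apply/seteqP; split.
  apply: smallest_sub; last by move=> s [//|[j]].
  apply/subring_setP; split.
  - split=> [|_ _ [a _ <-] [b _ <-]]; first by exists 0; rewrite ?rmorph0.
    by exists (a - b); rewrite ?rmorphB.
  - by exists 1; rewrite ?rmorph1.
  - by move=> _ _ [a _ <-] [b _ <-]; exists (a * b); rewrite ?rmorphM.
by apply: subset_trans (@sub_gen_smallest _ _ _) => s; left.
Qed.

Lemma mem_upto (i : nat) (j : 'I_n) : (j < i)%N -> R_ i (x j).
Proof. by move=> lt_ji; apply: sub_gen_smallest; right; exists j. Qed.

Lemma upto_le i j : (i <= j)%N -> R_ i `<=` R_ j.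
Proof.
move=> le_ij; apply: smallest_sub; first exact/subring_setP/subring_set_upto.
apply: subset_trans (@sub_gen_smallest _ _ _) => s [Rs|[k lt_ki <-]]; first by left.
by right; exists k => //; apply: leq_trans le_ij.
Qed.

Lemma uptoS (i : 'I_n) : R_ i.+1 = polys (x i) (R_ i).
Proof.
have [_ /(_ i) [_ _ -> _] _] := hS; apply/seteqP; split=> s.
  by case=> m /polys_ltP; exists m.
by case=> m /polys_ltP; exists m.
Qed.

Lemma upto_lead_inj (i : 'I_n) a d :
  R_ i a -> polys_lt (x i) (R_ i) d (a * x i ^+ d) -> a = 0.
Proof.
have [_ /(_ i) [_ _ _ free] _] := hS => Ra Fa.
have gR := subring_set_subgroup (subring_set_upto i).
have /polys_ltP [b [Rb aE]] := Fa.
pose c (k : 'I_d.+1) := if unlift ord_max k is Some l then b l else - a.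
rewrite -[a]opprK (_ : - a = c ord_max); last by rewrite /c unlift_none.
rewrite (free d.+1 c) ?oppr0 // => [k|].
  rewrite /c; case: unliftP => // _; apply: mem_set; exact: (subgroupN gR).
rewrite big_ord_recr /= [c ord_max]/c unlift_none mulNr aE; apply/eqP.
rewrite subr_eq0; apply/eqP/eq_bigr => k _.
rewrite /c (_ : widen_ord _ k = lift ord_max k) ?liftK //.
exact/val_inj/esym/lift_max.
Qed.

Lemma ad_upto (i : 'I_n) r : R_ i r -> ad (x i) r = delta i r.
Proof. by have [_ /(_ i) [_ xr _ _] _] := hS => Rr; apply: xr; exact: mem_set. Qed.

Lemma delta_upto (i : 'I_n) r : R_ i r -> R_ i (delta i r).
Proof.
have [_ /(_ i) [[dR _ _] _ _ _] _] := hS => Rr.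
by apply: set_mem; apply: dR; exact: mem_set.
Qed.


Definition later_variables i : set S := x @` [set j : 'I_n | (i <= j)%N].

Lemma later_variablesE (i : 'I_n) : later_variables i = x i |` later_variables i.+1.
Proof.
apply/seteqP; split=> [_ [j le_ij <-]|_ [->|[j lt_ij <-]]].
- move: le_ij; rewrite /= leq_eqVlt => /orP[/eqP ij|lt_ij]; last by right; exists j.
  by left; congr (x _); apply: val_inj.
- by exists i => /=.
- by exists j => //; apply: ltnW.
Qed.

Section Simplicity.
Hypothesis hc : forall J : set R, ideal J ->
  (forall i : 'I_n, delta i @` (iota @` J) `<=` iota @` J) ->
  J = [set 0] \/ J = setT.

Lemma base_simple J :
  stable_ideal (R_ 0) (later_variables 0) J -> ~ J 1 -> J `<=` [set 0].
Proof.
move=> stJ J1; have gJ := stable_subgroup stJ.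
have sJ : J `<=` range iota by rewrite -upto0; exact: (stable_subset stJ).
have Ri r : R_ 0 (iota r) by rewrite upto0; exists r.
have idJ : ideal (iota @^-1` J).
  split=> [|a r|a r].
  - split=> [|a b /set_mem Ja /set_mem Jb]; apply: mem_set.
      by rewrite /preimage /= rmorph0; exact: (subgroup0 gJ).
    by rewrite /preimage /= rmorphB; exact: (subgroupB gJ).
  - move=> /set_mem Ja; apply: mem_set; rewrite /preimage /= rmorphM.
    exact: (stable_mulr stJ).
  - move=> /set_mem Ja; apply: mem_set; rewrite /preimage /= rmorphM.
    exact: (stable_mull stJ).
case: (hc idJ) => [j _ [_ [r Jr <-] <-]|J0|JT].
- have Jd : J (delta j (iota r)).
    rewrite -ad_upto; first by apply: (stable_ad stJ) => //; exists j.
    by apply: upto_le (Ri r).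
  by have [r' _ dE] := sJ _ Jd; exists r' => //; rewrite /preimage /= dE.
- move=> s Js /=; have [r _ rs] := sJ _ Js.
  have : (iota @^-1` J) r by rewrite /preimage /= rs.
  by rewrite J0 -rs => /= ->; rewrite rmorph0.
- case: J1; rewrite -(rmorph1 iota); suff : (iota @^-1` J) 1 by [].
  by rewrite JT.
Qed.

End Simplicity.

Section Normalize.
Hypothesis ha : forall i : 'I_n, delta i @` range iota `<=` range iota.
Hypothesis hb : forall i j : 'I_n, (j < i)%N ->
  exists u v : S, [/\ u \in R_ j, v \in R_ j & delta i (x j) = u * x j + v].

Lemma ad_variable (i j : 'I_n) : (j < i)%N ->
  exists u v, [/\ R_ j u, R_ j v & ad (x i) (x j) = u * x j + v].
Proof.
move=> lt_ji; have [u [v [/set_mem Ru /set_mem Rv dE]]] := hb lt_ji.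
by exists u, v; split; rewrite // ad_upto //; apply: mem_upto.
Qed.

Lemma ad_upto_closed i (j : 'I_n) a : (i <= j)%N -> R_ i a -> R_ i (ad (x j) a).
Proof.
elim: i a => [|i IHi] a le_ij Ra.
  have -> : ad (x j) a = delta j a by apply: ad_upto; apply: upto_le Ra.
  by move: Ra; rewrite upto0 => -[r _ <-]; apply: ha; exists (iota r) => //; exists r.
pose i' := Ordinal (ltn_trans le_ij (ltn_ord j)).
move: Ra; rewrite (uptoS i'); have sR := subring_set_upto i.
have jR b : R_ i b -> R_ i (ad (x j) b) by apply: IHi; apply: ltnW.
apply: (@ad_polys _ _ (R_ i)) => //.
- by move=> b Rb; rewrite (ad_upto (i := i')) //; apply: (delta_upto (i := i')).
- exact: (ad_variable (j := i')).
- exact: subring_set_subgroup.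
- exact: subring_setM.
Qed.

Lemma ad_later_variables i y a : later_variables i y -> R_ i a -> R_ i (ad y a).
Proof. by move=> [j le_ij <-]; apply: ad_upto_closed. Qed.

Lemma iter_omega_in_upto i : (i <= n)%N ->
  (forall J, stable_ideal (R_ 0) (later_variables 0) J -> ~ J 1 -> J `<=` [set 0]) ->
  forall I, stable_ideal (R_ i) (later_variables i) I -> ~ I 1 ->
  iter i (omega_in (R_ i)) I `<=` [set 0].
Proof.
move=> + base; elim: i => [_|i IHi lt_in]; first exact: base.
pose i' := Ordinal lt_in; have sR := subring_set_upto i.
have YE := later_variablesE i'.
have RE : R_ i.+1 = polys (x i') (R_ i) := uptoS i'.
rewrite RE; apply: iter_omega_in_extension => //.
- by move=> a; apply: ad_later_variables; exists i' => /=.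
- by move=> y Yy a; apply: ad_later_variables; rewrite (YE : later_variables i = _); right.
- by move=> _ [j lt_ij <-]; apply: (ad_variable (j := i')).
- by move=> a d; apply: (upto_lead_inj (i := i')).
- by rewrite -YE; apply: IHi; apply: ltnW.
Qed.

End Normalize.

End Tower.

Theorem theorem3p6 (R : pzRingType) (n : nat) (S : pzRingType)
    (iota : {rmorphism R -> S}) (x : 'I_n -> S) (delta : 'I_n -> S -> S)
    (hR : right_noetherian R) (hn : (1 <= n)%N)
    (hS : iterated_diff_poly_ring iota x delta)
    (ha : forall i : 'I_n, delta i @` range iota `<=` range iota)
    (hb : forall i j : 'I_n, (j < i)%N ->
       exists u v : S,
         [/\ u \in subring_upto iota x j, v \in subring_upto iota x j &
             delta i (x j) = u * x j + v])
    (hc : forall J : set R, ideal J ->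
       (forall i : 'I_n, delta i @` (iota @` J) `<=` iota @` J) ->
       J = [set 0] \/ J = setT)
    (I : set S) (hI : ideal I) (hIproper : I <> setT) :
  ideal_iter_omega I n = [set 0].
Proof.
have RT : subring_upto iota x n = setT by case: hS.
have stI : stable_ideal (subring_upto iota x n) (later_variables (x := x) n) I.
  case: hI => [[I0 IB] Ir Il]; rewrite RT; split=> //.
  - split=> [|a b Ia Ib]; first exact: set_mem.
    by apply: set_mem; apply: IB; apply: mem_set.
  - by move=> c a _ Ia; apply: set_mem; apply: Il; apply: mem_set.
  - by move=> c a _ Ia; apply: set_mem; apply: Ir; apply: mem_set.
  - by move=> _ a [j /= le_nj <-]; move: (ltn_ord j); rewrite ltnNge le_nj.
have I1 : ~ I 1.
  move=> I1; apply: hIproper; apply/seteqP; split=> // s _.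
  by rewrite -[s]mulr1; apply: (stable_mull stI) => //; rewrite RT.
have -> : ideal_iter_omega I n = iter n (omega_in (subring_upto iota x n)) I.
  by rewrite RT.
apply/seteqP; split.
  exact: (iter_omega_in_upto hS ha hb (leqnn n) (base_simple hS hc)).
move=> _ /= ->; apply: (stable_ideal0 (C := subring_upto iota x n)).
apply: stable_ideal_iter_omega stI; first exact: subring_set_upto.
by move=> y b; apply: (ad_later_variables hS ha hb).
Qed.
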